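(* Let $k\ge1$ and let $g$ be one of $4k-1$, $4k+1$, $4k$, $4k+2$. Define $2\times g$ matrices $\overline{M_m}$ over $\mathbb{Z}/2$ by horizontal concatenation of blocks as follows. (a) If $g=4k-1$, for $0\le m\le 2k$: $\overline{M_{2i}}=\begin{pmatrix}A_{k+i}&\begin{matrix}0\\0\end{matrix}&A_{k-i}\end{pmatrix}$ for $0\le i\le k-1$; $\overline{M_{2i+1}}=\begin{pmatrix}A_{k+i}&\begin{matrix}1&0&1\\0&1&0\end{matrix}&A_{k-i-1}\end{pmatrix}$ for $0\le i\le k-2$; $\overline{M_{2k-1}}=\begin{pmatrix}A_{2k-1}&\begin{matrix}1&0\\0&1\end{matrix}\end{pmatrix}$; $\overline{M_{2k}}=A_{2k}$. (b) If $g=4k+1$, for $0\le m\le 2k+1$: $\overline{M_{2i}}=\begin{pmatrix}A_{k+i}&\begin{matrix}1&0&1\\0&1&0\end{matrix}&A_{k-i}\end{pmatrix}$ for $0\le i\le k-1$; $\overline{M_{2i+1}}=\begin{pmatrix}A_{k+i+1}&\begin{matrix}0\\0\end{matrix}&A_{k-i}\end{pmatrix}$ for $0\le i\le k-1$; $\overline{M_{2k}}=\begin{pmatrix}A_{2k}&\begin{matrix}1&0\\0&1\end{matrix}\end{pmatrix}$; $\overline{M_{2k+1}}=A_{2k+1}$. (c) If $g=4k$, for $0\le m\le 2k$: $\overline{M_{2i}}=\begin{pmatrix}A_{k+i}&\begin{matrix}1&1\\0&0\end{matrix}&A_{k-i}\end{pmatrix}$ for $0\le i\le k-1$; $\overline{M_{2i+1}}=\begin{pmatrix}A_{k+i+1}&A_{k-i}\end{pmatrix}$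 for $0\le i\le k-1$; $\overline{M_{2k}}=\begin{pmatrix}A_{2k}&\begin{matrix}1\\0\end{matrix}\end{pmatrix}$. (d) If $g=4k+2$, for $0\le m\le 2k+1$: $\overline{M_{2i}}=\begin{pmatrix}A_{k+i+1}&A_{k-i+1}\end{pmatrix}$ for $0\le i\le k$; $\overline{M_{2i+1}}=\begin{pmatrix}A_{k+i+1}&\begin{matrix}1&1\\0&0\end{matrix}&A_{k-i}\end{pmatrix}$ for $0\le i\le k-1$; $\overline{M_{2k+1}}=\begin{pmatrix}A_{2k+1}&\begin{matrix}1\\0\end{matrix}\end{pmatrix}$. Then, in each case and for every $m$ in the indicated range, $\overline{M_m}$ is in the same $\mathfrak{S}_{2g+2}$-orbit as $M_m$, where $M_0$ is the $2\times g$ zero matrix and, for $m\ge1$, $M_m=\begin{pmatrix}A_m&0\end{pmatrix}$ is the $2\times g$ matrix whose first $2m-1$ columns form $A_m$ and whose remaining columns (if any) are zero.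
   Context: $\Sigma_g$ is a compact connected oriented surface of genus $g$, and $\alpha_1,\dots,\alpha_g,\beta_1,\dots,\beta_g$ is a symplectic basis of $H_1(\Sigma_g,\mathbb{Z}/2)$, i.e. $\alpha_i\cdot\beta_j=\delta_{ij}$, $\alpha_i\cdot\alpha_j=\beta_i\cdot\beta_j=0$ for the mod 2 intersection number. A spin structure is a map $c:H_1(\Sigma_g,\mathbb{Z}/2)\to\mathbb{Z}/2$ with $c(x+y)=c(x)+c(y)+x\cdot y$ for all $x,y$; $\mathcal{C}$ is the set of spin structures. The corresponding matrix of $c$ is the $2\times g$ matrix $M$ over $\mathbb{Z}/2$ whose $i$-th column is $\begin{pmatrix}c(\alpha_i)\\c(\beta_i)\end{pmatrix}$; it determines $c$, every $2\times g$ matrix over $\mathbb{Z}/2$ arises, and spin structures are identified with their matrices. For $\gamma\in H_1(\Sigma_g,\mathbb{Z}/2)$ let $T_\gamma(x)=x+(x\cdot\gamma)\gamma$, an element of the group $Sp_{2g}(\mathbb{Z}/2)$ of automorphisms preserving the intersection number. Let $\sigma_i=(i,i+1)\in\mathfrak{S}_{2g+2}$, $1\le i\le 2g+1$, where $\mathfrak{S}_n$ is the symmetric group. The group $\mathfrak{S}_{2g+2}$ acts through the homomorphism $\iota:\mathfrak{S}_{2g+2}\to Sp_{2g}(\mathbb{Z}/2)$ determined by $\iota(\sigma_1)=T_{\beta_1}$, $\iota(\sigma_{2g+1})=T_{\beta_g}$, $\iota(\sigma_{2i})=T_{\alpha_i}$ ($1\le i\le g$), $\iota(\sigma_{2j+1})=T_{\beta_j+\beta_{j+1}}$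 ($1\le j\le g-1$). It acts on $\mathcal{C}$ (equivalently on the corresponding matrices) from the right by $c\circ\sigma:=c\circ\iota(\sigma)$. For $i\ge1$, $A_i$ is the $2\times(2i-1)$ matrix over $\mathbb{Z}/2$ whose odd-numbered columns are $\begin{pmatrix}1\\1\end{pmatrix}$ and whose even-numbered columns are $\begin{pmatrix}1\\0\end{pmatrix}$. *)

(* Defs.v *)
From HB Require Import structures.
From mathcomp Require Import all_boot all_order all_fingroup all_algebra.
From mathcomp Require Import zify.

Set Implicit Arguments.
Unset Strict Implicit.
Unset Printing Implicit Defensive.

Import GRing.Theory.
Local Open Scope ring_scope.

(* [H] stands for H_1(Sigma_g, Z/2) and [dot] for the mod 2 intersection
   number.  Bases are indexed from 0: [alpha i] is alpha_{i+1}. *)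

Section SpinStructures.
Variables (g : nat) (H : vectType 'F_2) (dot : {biscalar H}).
Variables (alpha beta : 'I_g -> H).

(* Alternation implies symmetry, so [dot (beta i) (alpha j)] is determined. *)
Record symplectic_basis : Prop := SymplecticBasis {
  dot_alternating : forall x, dot x x = 0;
  alpha_beta_basis : basis_of fullv (codom alpha ++ codom beta);
  dot_alpha_beta : forall i j, dot (alpha i) (beta j) = (i == j)%:R;
  dot_alpha_alpha : forall i j, dot (alpha i) (alpha j) = 0;
  dot_beta_beta : forall i j, dot (beta i) (beta j) = 0
}.

Definition in_Sp (f : 'End(H)) : Prop :=
  lker f = 0%VS /\ forall x y, dot (f x) (f y) = dot x y.

Definition transvection (gamma x : H) : H := x + dot x gamma *: gamma.

Definition spin_structure (c : H -> 'F_2) : Prop :=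
  forall x y, c (x + y) = c x + c y + dot x y.

Definition spin_mx (c : H -> 'F_2) : 'M['F_2]_(2, g) :=
  \matrix_(r, i) if r == 0 then c (alpha i) else c (beta i).

(* The transposition (i, i+1) of {1, ..., 2g+2}, for 1 <= i <= 2g+1, where the
   point j is represented by the ordinal of value j - 1. *)
Definition sigma (i : nat) : 'S_(2 * g).+2 := tperm (inord i.-1) (inord i).

(* In [iota_even] and [iota_odd], the shift of the indices of the basis turns
   sigma_{2i} into [sigma (2 * i.+1)]; [iota_odd] is the case where [i] and
   [j] are the indices of beta_j and beta_{j+1} in the usual numbering. *)
Record is_iota (iota : 'S_(2 * g).+2 -> 'End(H)) : Prop := IsIota {
  iota_Sp : forall s, in_Sp (iota s);
  iotaM : forall s t, iota (s * t)%g = (iota s \o iota t)%VF;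
  iota_first : forall i : 'I_g, i = 0%N :> nat ->
    iota (sigma 1) =1 transvection (beta i);
  iota_last : forall i : 'I_g, i.+1 = g ->
    iota (sigma (2 * g + 1)) =1 transvection (beta i);
  iota_even : forall i : 'I_g,
    iota (sigma (2 * i.+1)) =1 transvection (alpha i);
  iota_odd : forall i j : 'I_g, j = i.+1 :> nat ->
    iota (sigma (2 * i.+1 + 1)) =1 transvection (beta i + beta j)
}.

Variable iota : 'S_(2 * g).+2 -> 'End(H).

Definition spin_act (c : H -> 'F_2) (s : 'S_(2 * g).+2) : H -> 'F_2 :=
  fun x => c (iota s x).

Definition same_orbit (M N : 'M['F_2]_(2, g)) : Prop :=
  exists c d : H -> 'F_2,
    [/\ spin_structure c, spin_structure d, spin_mx c = M, spin_mx d = N &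
        exists s : 'S_(2 * g).+2, d =1 spin_act c s].

End SpinStructures.

(* A matrix with two rows is built from the sequence of its columns (a, b),
   with a the upper entry, so that horizontal concatenation of blocks is [++].
   The default value of [nth] is never used below: see the [size_] lemmas. *)
Definition col2 := ('F_2 * 'F_2)%type.

Definition mx_of_cols (g : nat) (s : seq col2) : 'M['F_2]_(2, g) :=
  \matrix_(r, j) if r == 0 then (nth (0, 0) s j).1 else (nth (0, 0) s j).2.

(* [j] counts columns from 0, hence the even [j] are the odd-numbered columns;
   [A 0] is empty. *)
Definition A (i : nat) : seq col2 :=
  mkseq (fun j => if odd j then (1, 0) else (1, 1)) (2 * i - 1).

(* The columns of M_m, including the zero matrix M_0. *)
Definition Mcols (g m : nat) : seq col2 :=
  A m ++ nseq (g - (2 * m - 1)) (0, 0).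

(* The columns of the matrix written M_m with a bar, in the cases g = 4k-1,
   4k+1, 4k and 4k+2 respectively; [m./2] is i for m = 2i and m = 2i+1. *)
Definition Mbar_a (k m : nat) : seq col2 :=
  let i := m./2 in
  if m == (2 * k)%N then A (2 * k)
  else if m == (2 * k - 1)%N then A (2 * k - 1) ++ [:: (1, 0); (0, 1)]
  else if odd m then
    A (k + i) ++ [:: (1, 0); (0, 1); (1, 0)] ++ A (k - i - 1)
  else A (k + i) ++ [:: (0, 0)] ++ A (k - i).

Definition Mbar_b (k m : nat) : seq col2 :=
  let i := m./2 in
  if m == (2 * k + 1)%N then A (2 * k + 1)
  else if m == (2 * k)%N then A (2 * k) ++ [:: (1, 0); (0, 1)]
  else if odd m then A (k + i + 1) ++ [:: (0, 0)] ++ A (k - i)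
  else A (k + i) ++ [:: (1, 0); (0, 1); (1, 0)] ++ A (k - i).

Definition Mbar_c (k m : nat) : seq col2 :=
  let i := m./2 in
  if m == (2 * k)%N then A (2 * k) ++ [:: (1, 0)]
  else if odd m then A (k + i + 1) ++ A (k - i)
  else A (k + i) ++ [:: (1, 0); (1, 0)] ++ A (k - i).

Definition Mbar_d (k m : nat) : seq col2 :=
  let i := m./2 in
  if m == (2 * k + 1)%N then A (2 * k + 1) ++ [:: (1, 0)]
  else if odd m then A (k + i + 1) ++ [:: (1, 0); (1, 0)] ++ A (k - i)
  else A (k + i + 1) ++ A (k - i + 1).

Lemma size_A i : size (A i) = (2 * i - 1)%N.
Proof. by rewrite size_mkseq. Qed.

Lemma size_Mcols g m : (2 * m - 1 <= g)%N -> size (Mcols g m) = g.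
Proof. by move=> ?; rewrite size_cat size_nseq size_A; lia. Qed.

Lemma size_Mbar_a k m : (0 < k)%N -> (m <= 2 * k)%N ->
  size (Mbar_a k m) = (4 * k - 1)%N.
Proof.
by move=> ? ?; rewrite /Mbar_a; do ![case: ifP => ?];
   rewrite ?size_cat ?size_A /=; lia.
Qed.

Lemma size_Mbar_b k m : (0 < k)%N -> (m <= 2 * k + 1)%N ->
  size (Mbar_b k m) = (4 * k + 1)%N.
Proof.
by move=> ? ?; rewrite /Mbar_b; do ![case: ifP => ?];
   rewrite ?size_cat ?size_A /=; lia.
Qed.

Lemma size_Mbar_c k m : (0 < k)%N -> (m <= 2 * k)%N ->
  size (Mbar_c k m) = (4 * k)%N.
Proof.
by move=> ? ?; rewrite /Mbar_c; do ![case: ifP => ?];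
   rewrite ?size_cat ?size_A /=; lia.
Qed.

Lemma size_Mbar_d k m : (0 < k)%N -> (m <= 2 * k + 1)%N ->
  size (Mbar_d k m) = (4 * k + 2)%N.
Proof.
by move=> ? ?; rewrite /Mbar_d; do ![case: ifP => ?];
   rewrite ?size_cat ?size_A /=; lia.
Qed.

(* Main.v *)
(** The curves d_0 = beta_1, d_1 = alpha_1, d_2 = beta_1 + beta_2, ...,
    d_{2g} = beta_g form a chain: d_m . d_n = 1 exactly when |m - n| = 1, and
    sigma_{n+1} acts as the transvection along d_n.  A spin structure c is
    encoded by a word w of length 2g + 2 over Z/2 with
    c(d_n) = 1 + w_n + w_{n+1}; then the symmetric group permutes the letters
    of w.  Two spin structures are therefore in the same orbit as soon as
    their words have the same number of 1s.  The word of a block A_i is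
    essentially constant, so these numbers are easily read off the matrices:
    both M_m and its barred version have g + 1 - 2m of them. *)

Require Import Defs.
From mathcomp Require Import all_boot all_order all_fingroup all_algebra.
From mathcomp Require Import zify ring.

Set Implicit Arguments.
Unset Strict Implicit.
Unset Printing Implicit Defensive.

Import GRing.Theory.
Local Open Scope ring_scope.

(** * Words over Z/2, and adjacent transpositions as generators *)

Lemma F2_cases (x : 'F_2) : x = 0 \/ x = 1.
Proof. by case: x => [[|[|n]] hn] //; [left | right]; apply: val_inj. Qed.

Lemma F2_addxx (x : 'F_2) : x + x = 0.
Proof. by case: (F2_cases x) => ->; apply: val_inj. Qed.

(** With two letters only, the length and the number of 1s determine the number of 0s. *)
Lemma perm_eq_F2 (s t : seq 'F_2) :
  size s = size t -> count_mem 1 s = count_mem 1 t -> perm_eq s t.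
Proof.
have c0 (u : seq 'F_2) : size u = addn (count_mem 0 u) (count_mem 1 u).
  elim: u => [|x u IH] //=; rewrite IH.
  by case: (F2_cases x) => -> /=; rewrite ?addnS.
move=> est e1; apply/allP => x _; apply/eqP; case: (F2_cases x) => -> //.
by apply: (@addIn (count_mem 1 t)); rewrite -[RHS]c0 -est c0 e1.
Qed.

(** The transpositions (0, y) generate, and for j > 0 the conjugate of (0, j) by (j, j+1) is (0,
    j+1). *)
Lemma gen_adjacent_tperm n :
  <<[set (tperm (inord i) (inord i.+1) : 'S_n.+1) | i : 'I_n]>>%g = setT.
Proof.
apply/eqP; rewrite eqEsubset subsetT /= -(gen_tperm ord0) gen_subG.
set G := <<_>>%G; apply/subsetP => _ /imsetP[y _ ->].
suff: forall j, (j <= n)%N -> tperm ord0 (inord j) \in G.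
  by move=> /(_ y); rewrite inord_val; apply; rewrite -ltnS.
elim=> [|j IH] hj.
  have -> : inord 0 = ord0 :> 'I_n.+1 by apply: val_inj; rewrite /= inordK.
  by rewrite tperm1 group1.
have hs : tperm (inord j) (inord j.+1) \in G.
  by apply: mem_gen; apply/imsetP; exists (Ordinal hj).
have [j0 | j0] := eqVneq j 0%N.
  suff e : inord 0 = ord0 :> 'I_n.+1 by move: hs; rewrite j0 e.
  by apply: val_inj; rewrite /= inordK.
have -> : tperm ord0 (inord j.+1) =
    (tperm ord0 (inord j) ^ tperm (inord j) (inord j.+1))%g :> 'S_n.+1.
  rewrite tpermJ tpermL tpermD // -val_eqE /= inordK //; lia.
by rewrite groupJ // IH // ltnW.
Qed.

(** * The word of a matrix *)

(* [x] is the sum of the upper entries of the columns already read, and [b] the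
   lower entry of the last one; [word 0 0 s] is the word of the matrix [s]. *)
Fixpoint word (x b : 'F_2) (s : seq col2) : seq 'F_2 :=
  if s is (a, b') :: s' then [:: x + b, 1 + x + b' & word (x + a) b' s']
  else [:: x + b; 1 + x].

Lemma size_word x b s : size (word x b s) = (2 * size s).+2.
Proof. by elim: s x b => [|[a b'] s IH] x b //=; rewrite IH; lia. Qed.

(** The relation c(d_n) = 1 + w_n + w_{n+1} for n = 2j + 1, where d_n = alpha_{j+1}. *)
Lemma word_odd x b s j : (j < size s)%N ->
  (nth (0, 0) s j).1 = 1 + (word x b s)`_(j.*2.+1) + (word x b s)`_(j.*2.+2).
Proof.
elim: s j x b => [|[a b'] s IH] [|j] x b //= hj; last exact: IH.
have -> : (word (x + a) b' s)`_0 = x + a + b' by case: s {IH hj} => [|[]].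
by move: (F2_cases x) (F2_cases a) (F2_cases b') => [] -> [] -> [] ->; apply: val_inj.
Qed.

(** The same relation for n = 2j, where d_n = beta_j + beta_{j+1}. For [b = 0], the added column and
    the default of [nth] account for beta_0 = beta_{g+1} = 0. *)
Lemma word_even x b s j : (j <= size s)%N ->
  (nth (0, 0) ((0, b) :: s) j).2 + (nth (0, 0) s j).2 =
  1 + (word x b s)`_(j.*2) + (word x b s)`_(j.*2.+1).
Proof.
elim: s j x b => [|[a b'] s IH] [|j] x b //= hj; last by rewrite -IH //; case: j {hj}.
  by case: (F2_cases x) => ->; case: (F2_cases b) => ->; apply: val_inj.
by move: (F2_cases x) (F2_cases b) (F2_cases b') => [] -> [] -> [] ->; apply: val_inj.
Qed.

(** * Numbers of 1s in the words of the matrices *)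

Lemma A_rec i : A i.+2 = [:: (1, 1), (1, 0) & A i.+1].
Proof.
rewrite /A (_ : 2 * i.+2 - 1 = 2 + (2 * i.+1 - 1))%N; last by lia.
rewrite /mkseq iotaD map_cat /= (iotaDl 2 0) -map_comp.
by congr [:: _, _ & _]; apply: eq_map => j /=; rewrite negbK.
Qed.

(** A column (1, 1) leads from the state [(x, b)] to [(1 + x, 1)], and a further column (1, 0) to
    [(x, 0)]; every letter written on the way, except the first, is x. *)
Lemma word_A x b i t : (0 < i)%N ->
  word x b (A i ++ t) = (x + b) :: nseq (4 * i - 3) x ++ word (1 + x) 1 t.
Proof.
have e : 1 + x + 1 = x by case: (F2_cases x) => ->; apply: val_inj.
have A1 : A 1 = [:: (1, 1)] by [].
case: i => // i _; elim: i b => [|i IH] b; first by rewrite A1 /= e (addrC x 1).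
rewrite (_ : 4 * i.+2 - 3 = 4 + (4 * i.+1 - 3))%N ?nseqD; last by lia.
rewrite A_rec /= e (addrC x 1) e addr0 IH.
by rewrite addrA F2_addxx add0r addr0.
Qed.

Lemma word_A_last x b i : (0 < i)%N ->
  word x b (A i) = (x + b) :: nseq (4 * i - 1) x.
Proof.
move=> hi; rewrite -[A i]cats0 word_A //=.
rewrite (_ : 4 * i - 1 = (4 * i - 3) + 2)%N ?nseqD; last by lia.
by rewrite addrA F2_addxx add0r addrAC F2_addxx add0r.
Qed.

(** After its first letter the word alternates between 1 + x and x, beginning and ending with 1 +
    x. *)
Lemma count_word_zeros x b n :
  count_mem 1 (word x b (nseq n (0, 0))) = ((x + b == 1)%R + (x == 0)%R + n)%N.
Proof.
elim: n b => [|n IH] b /=; last rewrite !addr0 IH;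
  by case: (F2_cases x) => ->; case: (F2_cases b) => ->.
Qed.

Definition word_countE := (addr0, add0r, F2_addxx, count_cat, count_nseq, cats0).

Lemma count_word_Mcols g m : (2 * m - 1 <= g)%N ->
  count_mem 1 (word 0 0 (Mcols g m)) = (g + 1 - 2 * m)%N.
Proof.
rewrite /Mcols; case: m => [|m] hm; first by rewrite subn0 count_word_zeros /=; lia.
by rewrite word_A //= !word_countE count_word_zeros /=; lia.
Qed.

(** In all four families the first block is read from [x = 0] and gives only 0s. A second block, if
    any, is reached with [x = 1] and gives 1s, except that its first letter is 0 when it directly
    follows the first block. *)
Lemma count_word_Mbar_a k m : (0 < k)%N -> (m <= 2 * k)%N ->
  count_mem 1 (word 0 0 (Mbar_a k m)) = (4 * k - 2 * m)%N.
Proof.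
move=> hk hm; rewrite /Mbar_a; do ![case: ifP => ?];
  rewrite ?(word_A, word_A_last) /= ?(word_A, word_A_last) /=; try lia;
  by do 3!rewrite ?word_countE /=; lia.
Qed.

Lemma count_word_Mbar_b k m : (0 < k)%N -> (m <= 2 * k + 1)%N ->
  count_mem 1 (word 0 0 (Mbar_b k m)) = (4 * k + 2 - 2 * m)%N.
Proof.
move=> hk hm; rewrite /Mbar_b; do ![case: ifP => ?];
  rewrite ?(word_A, word_A_last) /= ?(word_A, word_A_last) /=; try lia;
  by do 3!rewrite ?word_countE /=; lia.
Qed.

Lemma count_word_Mbar_c k m : (0 < k)%N -> (m <= 2 * k)%N ->
  count_mem 1 (word 0 0 (Mbar_c k m)) = (4 * k + 1 - 2 * m)%N.
Proof.
move=> hk hm; rewrite /Mbar_c; do ![case: ifP => ?];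
  rewrite ?(word_A, word_A_last) /= ?(word_A, word_A_last) /=; try lia;
  by do 3!rewrite ?word_countE /=; lia.
Qed.

Lemma count_word_Mbar_d k m : (0 < k)%N -> (m <= 2 * k + 1)%N ->
  count_mem 1 (word 0 0 (Mbar_d k m)) = (4 * k + 3 - 2 * m)%N.
Proof.
move=> hk hm; rewrite /Mbar_d; do ![case: ifP => ?];
  rewrite ?(word_A, word_A_last) /= ?(word_A, word_A_last) /=; try lia;
  by do 3!rewrite ?word_countE /=; lia.
Qed.

(** * Intersection numbers along the chain *)

Section Chain.
Context (g : nat) (H : vectType 'F_2) (dot : {biscalar H}).
Context (alpha beta : 'I_g -> H) (hb : symplectic_basis dot alpha beta).
Implicit Types (c : H -> 'F_2) (x y : H) (s : seq col2).

Lemma dotC x y : dot x y = dot y x.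
Proof.
have := dot_alternating hb (x + y).
rewrite linearDl !linearDr /= !(dot_alternating hb) add0r addr0.
by case: (F2_cases (dot x y)) => ->; case: (F2_cases (dot y x)) => ->.
Qed.

(* In [be] the index is shifted so that [be 0 = be g.+1 = 0]; this makes
   beta_1 and beta_g, at the ends of the chain, instances of be_j + be_{j+1}. *)
Definition al n : H := oapp alpha 0 (insub n).
Definition be n : H := if n is n'.+1 then oapp beta 0 (insub n') else 0.
Definition chain n : H := if odd n then al n./2 else be n./2 + be n./2.+1.

Lemma alE (i : 'I_g) : al i = alpha i. Proof. by rewrite /al valK. Qed.
Lemma beE (i : 'I_g) : be i.+1 = beta i. Proof. by rewrite /be valK. Qed.

Lemma dot_al_al i j : dot (al i) (al j) = 0.
Proof.
rewrite /al; case: insubP => [a _ _|_] /=; last by rewrite linear0l.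
by case: insubP => [b _ _|_] /=; rewrite ?linear0 // (dot_alpha_alpha hb).
Qed.

Lemma dot_be_be i j : dot (be i) (be j) = 0.
Proof.
case: i j => [|i] [|j] /=; rewrite ?linear0l ?linear0 //.
case: insubP => [a _ _|_] /=; last by rewrite linear0l.
by case: insubP => [b _ _|_] /=; rewrite ?linear0 // (dot_beta_beta hb).
Qed.

Lemma dot_al_be i j : dot (al i) (be j) = ((i < g)%N && (j == i.+1))%:R.
Proof.
case: j => [|j] /=; first by rewrite linear0 andbF.
rewrite /al; case: insubP => [a ha ea|hi] /=; last by rewrite linear0l (negPf hi).
rewrite ha eqSS; case: insubP => [b hj eb|hj] /=.
  by rewrite (dot_alpha_beta hb) -val_eqE /= ea eb eq_sym.
by rewrite linear0; case: eqP => // e; move: hj; rewrite e ha.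
Qed.

Arguments be : simpl never.

Lemma dot_chain m n : (m <= 2 * g)%N -> (n <= 2 * g)%N ->
  dot (chain m) (chain n) = ((m == n.+1) || (n == m.+1))%:R.
Proof.
(* Symmetry turns the case of m even, n odd into that of m odd, n even. *)
wlog h : m n / odd m || ~~ odd n.
  move=> W hm hn; case h: (odd m || ~~ odd n); first exact: W.
  by rewrite dotC orbC W //; lia.
move=> hm hn; rewrite /chain.
case om: (odd m) h; case on: (odd n) => //= _.
- by rewrite dot_al_al; case: eqP => //=; [lia|]; case: eqP => //=; lia.
- rewrite linearDr /= !dot_al_be (_ : m./2 < g)%N; last by lia.
  have -> : (n./2 == m./2.+1) = (n == m.+1) by apply/eqP/eqP; lia.
  have -> : (n./2.+1 == m./2.+1) = (m == n.+1) by apply/eqP/eqP; lia.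
  by case: eqP => e1; case: eqP => e2; rewrite ?addr0 ?add0r //; exfalso; lia.
- rewrite linearDl !linearDr /= !dot_be_be !addr0.
  by case: eqP => //=; [lia|]; case: eqP => //=; lia.
Qed.

(** * Spin structures, their matrices and their words *)

Lemma spin0 c : spin_structure dot c -> c 0 = 0.
Proof.
by move=> /(_ 0 0); rewrite addr0 linear0 addr0; case: (F2_cases (c 0)) => ->.
Qed.

Lemma spin_transvection c x y : spin_structure dot c ->
  c (transvection dot y x) = c x + dot x y * (1 + c y).
Proof.
move=> hc; rewrite /transvection; case: (F2_cases (dot x y)) => e; rewrite e.
  by rewrite scale0r mul0r !addr0.
by rewrite scale1r mul1r hc e -addrA (addrC 1).
Qed.

(** A relation rather than a function of [c], since w and 1 + w encode the same [c]. *)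
Definition has_word c (w : 'I_(2 * g).+2 -> 'F_2) := forall n, (n <= 2 * g)%N ->
  c (chain n) = 1 + w (inord n) + w (inord n.+1).

Lemma spin_mx_eq c s : size s = g ->
  spin_mx alpha beta c = mx_of_cols g s <->
  forall i : 'I_g, c (alpha i) = (nth (0, 0) s i).1 /\ c (beta i) = (nth (0, 0) s i).2.
Proof.
move=> hs; split=> [/matrixP e i|e].
  by have := e 0 i; have := e 1 i; rewrite !mxE.
by apply/matrixP => r i; rewrite !mxE; case: (e i) => -> ->.
Qed.

(** The matrix gives every c(d_n). Conversely alpha_{j+1} is d_{2j+1}, and c(beta_{j+1}) follows
    from c(beta_j) and c(d_{2j}), starting from [be 0 = 0]. *)
Lemma has_wordP c s : size s = g -> spin_structure dot c ->
  spin_mx alpha beta c = mx_of_cols g s <->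
  has_word c (fun i => (word 0 0 s)`_i).
Proof.
move=> hs hc; rewrite spin_mx_eq //.
have cB j : c (be j + be j.+1) = c (be j) + c (be j.+1).
  by rewrite hc dot_be_be addr0.
have be_g : be g.+1 = 0 by rewrite /be insubF ?ltnn.
split=> [e n hn|e].
  (* At [j = g.+1] the default (0, 0) of [nth] agrees with c(0) = 0. *)
  have eB j : (j <= g.+1)%N -> c (be j) = (nth (0, 0) ((0, 0) :: s) j).2.
    rewrite leq_eqVlt => /orP[/eqP->|]; first by rewrite be_g spin0 //= nth_default ?hs.
    case: j => [|j] hj; first by rewrite spin0.
    rewrite ltnS in hj; rewrite (beE (Ordinal hj) : be j.+1 = _) /=.
    by case: (e (Ordinal hj)).
  rewrite /= !inordK //; last by lia.
  rewrite /chain; case on: (odd n).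
    have en : n = n./2.*2.+1 by lia.
    have hj : (n./2 < g)%N by lia.
    rewrite [in RHS]en -word_odd ?hs // (alE (Ordinal hj) : al n./2 = _).
    by case: (e (Ordinal hj)).
  have en : n = n./2.*2 by lia.
  by rewrite [in RHS]en -word_even ?hs ?cB ?eB //; lia.
have ca (i : 'I_g) : c (alpha i) = (nth (0, 0) s i).1.
  have hi := ltn_ord i.
  have := e i.*2.+1; rewrite /chain /= odd_double uphalf_double alE => ->; last by lia.
  by rewrite /= !inordK -?word_odd ?hs //; lia.
have cb j : (j <= g)%N -> c (be j) = (nth (0, 0) ((0, 0) :: s) j).2.
  elim: j => [|j IH] hj; first by rewrite spin0.
  have := e j.*2; rewrite /chain /= odd_double doubleK cB /= !inordK; try lia.
  rewrite (IH (ltnW hj)) -word_even ?hs ?(ltnW hj) // => h.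
  by apply: addrI; apply: h; lia.
by move=> i; rewrite ca -beE cb ?ltn_ord.
Qed.

(** The only scalars are 0 and 1, so an additive map is linear and determined on the basis. *)
Lemma additive_eq0 (f : H -> 'F_2) : {morph f : x y / x + y} ->
  (forall i, f (alpha i) = 0) -> (forall i, f (beta i) = 0) -> f =1 fun=> 0.
Proof.
move=> fD fa fb x; have f0 : f 0 = 0.
  by have := fD 0 0; rewrite addr0; case: (F2_cases (f 0)) => ->.
set X := in_tuple (codom alpha ++ codom beta).
rewrite (coord_basis (X := X) (alpha_beta_basis hb) (memvf x)).
apply: (big_ind (fun v => f v = 0)) => // [u v fu fv | i _].
  by rewrite fD fu fv addr0.
have : X`_i \in codom alpha ++ codom beta by rewrite mem_nth.
case: (F2_cases (coord X i x)) => ->; rewrite ?scale0r // scale1r mem_cat.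
by case/orP => /codomP[j ->].
Qed.

(** For fixed x, the difference of the two sides is additive in y and vanishes on the basis. *)
Lemma dot_expand x y : dot x y =
  \sum_i (dot x (beta i) * dot y (alpha i) + dot x (alpha i) * dot y (beta i)).
Proof.
apply/eqP; rewrite -subr_eq0; apply/eqP.
pose f y := dot x y -
  \sum_i (dot x (beta i) * dot y (alpha i) + dot x (alpha i) * dot y (beta i)).
apply: (@additive_eq0 f) => [u v|i|i]; rewrite /f.
- rewrite linearDr /= addrACA -opprD -big_split /=; congr (_ + _ - _).
  by apply: eq_bigr => i _; rewrite !linearDl /= !mulrDr addrACA.
- rewrite (bigD1 i) //= (dot_alpha_alpha hb) (dot_alpha_beta hb) eqxx mulr0 mulr1 add0r.
  rewrite big1 ?addr0 ?subrr // => j ji.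
  by rewrite (dot_alpha_alpha hb) (dot_alpha_beta hb) eq_sym (negPf ji) !mulr0 addr0.
- rewrite (bigD1 i) //= (dot_beta_beta hb) dotC (dotC _ (alpha i)).
  rewrite (dot_alpha_beta hb) eqxx mulr0 mulr1 addr0 (dotC (beta i)).
  rewrite big1 ?addr0 ?subrr // => j ji.
  by rewrite (dot_beta_beta hb) dotC (dotC (beta i)) (dot_alpha_beta hb) (negPf ji) !mulr0 addr0.
Qed.

(* The sum of the products of the symplectic coordinates of [x] is a spin
   structure, and adding a linear form prescribes the values on the basis. *)
Lemma spin_of_cols s : size s = g ->
  exists2 c, spin_structure dot c & spin_mx alpha beta c = mx_of_cols g s.
Proof.
move=> hs; exists (fun x => \sum_i (dot x (beta i) * dot x (alpha i) +
  (dot x (beta i) * (nth (0, 0) s i).1 + dot x (alpha i) * (nth (0, 0) s i).2))).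
  move=> x y; rewrite dot_expand -!big_split /=; apply: eq_bigr => i _.
  by rewrite !linearDl /=; ring.
rewrite spin_mx_eq // => i; split.
  rewrite (bigD1 i) //= big1 => [|j ji];
    rewrite !(dot_alpha_beta hb) !(dot_alpha_alpha hb).
    by rewrite eqxx mulr0 mul1r mul0r add0r !addr0.
  by rewrite eq_sym (negPf ji) !mul0r !addr0.
rewrite (bigD1 i) //= big1 => [|j ji];
  rewrite !(dot_beta_beta hb) (dotC _ (alpha _)) !(dot_alpha_beta hb).
  by rewrite eqxx !mul0r mul1r !add0r addr0.
by rewrite (negPf ji) !mul0r !addr0.
Qed.

(** * The action of the symmetric group on words *)

Context (iota : 'S_(2 * g).+2 -> 'End(H)) (hi : is_iota dot alpha beta iota).

Lemma iota_chain n : (0 < g)%N -> (n <= 2 * g)%N ->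
  iota (sigma g n.+1) =1 transvection dot (chain n).
Proof.
move=> g0 hn x; rewrite /chain; case on: (odd n).
  have hj : (n./2 < g)%N by lia.
  rewrite (alE (Ordinal hj) : al n./2 = _) -(iota_even hi) /=.
  by rewrite (_ : n.+1 = 2 * n./2.+1)%N //; lia.
have [n0 | n0] := eqVneq n 0%N.
  rewrite n0 add0r (beE (Ordinal g0) : be 1 = _); exact: (iota_first hi).
have h1 : (n./2.-1 < g)%N by lia.
have e1 : n./2 = n./2.-1.+1 by lia.
have [ng | ng] := eqVneq n (2 * g)%N.
  rewrite (_ : be n./2.+1 = 0) ?addr0; last first.
    by rewrite /be insubF //; apply/negbTE; lia.
  rewrite e1 (beE (Ordinal h1) : be n./2.-1.+1 = _) (_ : n.+1 = 2 * g + 1)%N; last by lia.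
  by apply: (iota_last hi); rewrite /=; lia.
have h2 : (n./2 < g)%N by lia.
rewrite (beE (Ordinal h2) : be n./2.+1 = _) (_ : be n./2 = beta (Ordinal h1)); last first.
  by rewrite -(beE (Ordinal h1)) -e1.
rewrite (_ : n.+1 = 2 * (Ordinal h1).+1 + 1)%N; last by rewrite /=; lia.
by apply: (iota_odd hi) => /=.
Qed.

Lemma spin_act_spin c p :
  spin_structure dot c -> spin_structure dot (spin_act iota c p).
Proof.
by move=> hc x y; rewrite /spin_act linearD hc; case: (iota_Sp hi p) => _ ->.
Qed.

(** Only d_{n-1} and d_{n+1} meet d_n; there c changes by 1 + c(d_n) = w_n + w_{n+1}, which is the
    effect of exchanging w_n and w_{n+1}. The value c(d_n) is symmetric in these two letters. *)
Lemma has_word_sigma c w n : (0 < g)%N -> (n <= 2 * g)%N -> spin_structure dot c ->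
  has_word c w ->
  has_word (spin_act iota c (sigma g n.+1)) (w \o sigma g n.+1).
Proof.
move=> g0 hn hc hw m hm; rewrite /spin_act iota_chain // spin_transvection //.
rewrite dot_chain // !hw //= /sigma /=.
have inordE a b : (a <= (2 * g).+1)%N -> (b <= (2 * g).+1)%N ->
    (inord a == inord b :> 'I_(2 * g).+2) = (a == b).
  by move=> ha hb'; rewrite -val_eqE /= !inordK.
(* [wE] serves for m = n + 1 and [wE'] for m = n - 1. *)
have wE (a b d : 'F_2) : 1 + a + b + (1 + (1 + d + a)) = 1 + d + b.
  by move: (F2_cases a) (F2_cases b) (F2_cases d) => [] -> [] -> [] ->; apply: val_inj.
have wE' (a b d : 'F_2) : 1 + a + b + (1 + (1 + b + d)) = 1 + a + d.
  by move: (F2_cases a) (F2_cases b) (F2_cases d) => [] -> [] -> [] ->; apply: val_inj.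
have [->|mn] := eqVneq m n.
  by rewrite (ltn_eqF (ltnSn _)) mul0r addr0 tpermL tpermR addrAC.
have [mn1|mn1] := eqVneq m n.+1.
  rewrite mn1 tpermR mul1r tpermD ?inordE; try lia.
  exact: wE.
rewrite (@tpermD _ _ _ (inord m)) ?inordE; try lia.
have [mn2|mn2] := eqVneq n m.+1.
  by rewrite mn2 tpermL mul1r wE'.
by rewrite mul0r addr0 tpermD ?inordE //; lia.
Qed.

(** The inverse reconciles two orders of composition: [iota (s * t)] applies [iota t] first, whereas
    the permutation [s * t] applies [s] first. *)
Lemma has_word_act c w p : (0 < g)%N -> spin_structure dot c -> has_word c w ->
  has_word (spin_act iota c p) (w \o p^-1%g).
Proof.
move=> g0 hc hw; have : p \in [set: 'S_(2 * g).+2] by rewrite inE.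
rewrite -gen_adjacent_tperm => /gen_prodgP[n [q hq ->]].
elim: n q hq => [|n IH] q hq.
  rewrite big_ord0 invg1 => m hm.
  have -> : spin_act iota c 1%g (chain m) = c (chain m).
    (* [iota 1] is idempotent and injective, hence the identity. *)
    congr c; case: (iota_Sp hi 1%g) => /eqP/lker0P inj _; apply: inj.
    by rewrite -comp_lfunE -(iotaM hi) mulg1.
  by rewrite /= !perm1 hw.
rewrite big_ord_recr /= => m hm; rewrite invMg.
have /imsetP[i _ ->] := hq ord_max.
have hP := IH (fun i => q (widen_ord (leqnSn n) i)) (fun i => hq _).
have := has_word_sigma g0 _ (spin_act_spin _ hc) hP (n := i).
rewrite /sigma /= => /(_ _ m hm) e.
rewrite /spin_act (iotaM hi) comp_lfunE tpermV /= !permM.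
by apply: e; have := ltn_ord i; lia.
Qed.

Lemma same_orbit_perm_word s t : (0 < g)%N -> size s = g -> size t = g ->
  perm_eq (word 0 0 s) (word 0 0 t) ->
  same_orbit dot alpha beta iota (mx_of_cols g s) (mx_of_cols g t).
Proof.
move=> g0 hs ht hp; have [c hc ec] := spin_of_cols hs.
have hw := (has_wordP hs hc).1 ec.
have sz u : size u = g -> size (word 0 0 u) == (2 * g).+2 by rewrite size_word => ->.
have /tuple_permP[p ep] : perm_eq (word 0 0 t) (Tuple (sz s hs)) by rewrite perm_sym.
(* Acting by the inverse of [p] composes the word of [s] with [p] itself, which gives the word of
   [t]. *)
exists c, (spin_act iota c p^-1%g); split=> //; first exact: spin_act_spin.
  apply/(has_wordP ht (spin_act_spin _ hc)) => n hn.
  rewrite (has_word_act _ g0 hc hw hn) /= invgK ep.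
  by rewrite -!tnth_nth !tnth_mktuple !(tnth_nth 0).
by exists p^-1%g.
Qed.

End Chain.

(* Equal numbers of 1s in the four cases *)
Local Close Scope ring_scope.

Theorem proposition4p3 (k g : nat) (hk : (1 <= k)%N)
  (H : vectType 'F_2) (dot : {biscalar H}%R) (alpha beta : 'I_g -> H)
  (hbasis : symplectic_basis dot alpha beta)
  (iota : 'S_(2 * g).+2 -> 'End(H)) (hiota : is_iota dot alpha beta iota) :
  [/\ g = (4 * k - 1)%N -> forall m : nat, (m <= 2 * k)%N ->
        same_orbit dot alpha beta iota
          (mx_of_cols g (Mbar_a k m)) (mx_of_cols g (Mcols g m)),
      g = (4 * k + 1)%N -> forall m : nat, (m <= 2 * k + 1)%N ->
        same_orbit dot alpha beta iota
          (mx_of_cols g (Mbar_b k m)) (mx_of_cols g (Mcols g m)),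
      g = (4 * k)%N -> forall m : nat, (m <= 2 * k)%N ->
        same_orbit dot alpha beta iota
          (mx_of_cols g (Mbar_c k m)) (mx_of_cols g (Mcols g m)) &
      g = (4 * k + 2)%N -> forall m : nat, (m <= 2 * k + 1)%N ->
        same_orbit dot alpha beta iota
          (mx_of_cols g (Mbar_d k m)) (mx_of_cols g (Mcols g m))].
Proof.
split=> eg m hm; apply: (same_orbit_perm_word hbasis hiota);
  rewrite ?size_Mbar_a ?size_Mbar_b ?size_Mbar_c ?size_Mbar_d ?size_Mcols //;
  try lia; apply: perm_eq_F2;
  rewrite ?size_word ?size_Mbar_a ?size_Mbar_b ?size_Mbar_c ?size_Mbar_d
    ?size_Mcols ?count_word_Mbar_a ?count_word_Mbar_b ?count_word_Mbar_c
    ?count_word_Mbar_d ?count_word_Mcols //; lia.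
Qed.
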